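(* For each positive integer $m$ there is an integer $t_0$ such that for every integer $t\ge t_0$ the independence polynomial $I(TG_{m,t})=\sum_{k\ge 0}s_k x^k$ of the tree $TG_{m,t}$ breaks log-concavity at $m$ indices, i.e. there are $m$ distinct indices $k$ with $s_k^2< s_{k-1}s_{k+1}$.
   Context: For a simple graph $G$, the independence polynomial is $I(G)=\sum_{k\ge0}s_kx^k$, where $s_k$ is the number of independent sets of $G$ of size $k$. A sequence $(s_k)$ breaks log-concavity at index $k$ if $s_k^2<s_{k-1}s_{k+1}$. Let $P_n$ be the path on $n$ vertices. For nonnegative integers $m,t$: $S_{2,t}$ is the tree with a root $w$ to which $t$ copies of $P_2$ are attached (i.e. $w$ is adjacent to one endpoint of each copy); $T_{m,t}$ is the tree with a root $v$ having $m$ children, each of which has $t$ pendant copies of $P_2$ attached; $TG_{m,t}$ is obtained by taking $m$ disjoint copies of $T_{3,t}$, joining the root $v$ of each copy to a new vertex $v_0$, and adding one further vertex adjacent only to $v_0$. *)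

(* Defs.v *)
From mathcomp Require Import all_boot all_order all_algebra.

Set Implicit Arguments.
Unset Strict Implicit.
Unset Printing Implicit Defensive.

Import GRing.Theory Num.Theory.

Record sgraph := SGraph {
  vertex :> finType;
  adj : rel vertex;
  adj_sym : symmetric adj;
  adj_irr : irreflexive adj }.

Record rgraph := RGraph {
  ugraph :> sgraph;
  root : ugraph }.

Definition independent (G : sgraph) (A : {set G}) : bool :=
  [forall x in A, forall y in A, ~~ adj x y].

Definition num_indep (G : sgraph) (k : nat) : nat :=
  #|[set A : {set G} | independent A & #|A| == k]|.

(* The sum stops at #|G| because an independent set has at most #|G| elements. *)
Definition indep_poly (G : sgraph) : {poly int} :=
  (\sum_(k < #|G|.+1) (num_indep G k)%:R *: 'X^k)%R.

(* At k = 0 the inequality would involve s_(-1), which is 0 mathematically but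
   which k.-1 would read as s_0; hence the explicit 0 < k. *)
Definition breaks_log_concavity (s : nat -> int) (k : nat) : bool :=
  (0 < k)%N && (s k ^+ 2 < s k.-1 * s k.+1)%R.

Section Path.
Variable n : nat.

Definition path_adj (i j : 'I_n) : bool :=
  (i.+1 == j :> nat) || (j.+1 == i :> nat).

Lemma path_adj_sym : symmetric path_adj.
Proof. by move=> i j; rewrite /path_adj orbC. Qed.

Lemma path_adj_irr : irreflexive path_adj.
Proof. by move=> i; rewrite /path_adj orbb eqn_leq ltnn. Qed.

Definition pathG : sgraph := SGraph path_adj_sym path_adj_irr.
End Path.

Definition rooted_path (n : nat) : rgraph := @RGraph (pathG n.+1) ord0.

(* [attach n G] is a new root, None, joined to the roots of n disjoint copies
   of G; vertex a of the i-th copy is Some (i, a). *)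
Section Attach.
Variables (n : nat) (G : rgraph).

Definition attach_adj (x y : option ('I_n * G)) : bool :=
  match x, y with
  | None, None => false
  | None, Some (_, b) => b == root G
  | Some (_, a), None => a == root G
  | Some (i, a), Some (j, b) => (i == j) && adj a b
  end.

Lemma attach_adj_sym : symmetric attach_adj.
Proof. by move=> [[i a]|] [[j b]|] //=; rewrite eq_sym adj_sym. Qed.

Lemma attach_adj_irr : irreflexive attach_adj.
Proof. by move=> [[i a]|] //=; rewrite adj_irr andbF. Qed.

Definition attach : rgraph :=
  @RGraph (SGraph attach_adj_sym attach_adj_irr) None.
End Attach.

(* [add_pendant G] is G with one further vertex, None, adjacent only to the
   root of G. *)
Section Pendant.
Variable G : rgraph.

Definition pendant_adj (x y : option G) : bool :=
  match x, y with
  | None, None => false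
  | None, Some b => b == root G
  | Some a, None => a == root G
  | Some a, Some b => adj a b
  end.

Lemma pendant_adj_sym : symmetric pendant_adj.
Proof. by move=> [a|] [b|] //=; rewrite adj_sym. Qed.

Lemma pendant_adj_irr : irreflexive pendant_adj.
Proof. by move=> [a|] //=; rewrite adj_irr. Qed.

Definition add_pendant : sgraph := SGraph pendant_adj_sym pendant_adj_irr.
End Pendant.

Definition treeS2 (t : nat) : rgraph := attach t (rooted_path 1).

Definition treeT (m t : nat) : rgraph := attach m (treeS2 t).

Definition treeTG (m t : nat) : sgraph := add_pendant (attach m (treeT 3 t)).

(* Main.v *)
(* Put q = 2^t, A = (1+2x)^t, B = (1+x)^t, S = A + xB = I(S_{2,t}) and
   T = S^3 + xA^3 = I(T_{3,t}).  Then I(TG_{m,t}) = (1+x)T^m + xS^{3m}, of degree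
   N = m(3t+3)+1.  Up to factors polynomial in t, lowering the degree in T by 1
   gains a factor q (a term 3x^2AB^2 of S^3) while lowering it by 2 gains q^3 (the
   term xA^3).  Hence the coefficient of x^{N-2i} is at least q^{3i} for i <= m,
   while that of x^{N-2i-1} is at most D^{O(m)} q^{3i+1} with D linear in t.  As
   q^{3i} q^{3i+3} = q (q^{3i+1})^2, log-concavity breaks at N-2i-1 for every
   i < m as soon as q = 2^t exceeds the polynomial factor. *)
From mathcomp Require Import all_boot all_order all_algebra.
From mathcomp Require Import zify.
Require Import Defs.

Set Implicit Arguments.
Unset Strict Implicit.
Unset Printing Implicit Defensive.

Import GRing.Theory Num.Theory.

(** * Generating polynomials of restricted families of independent sets *)

(** Coefficients lie in [nat], so any term of a sum or convolution is a lower bound for the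
    whole. *)
Definition indep_gen (G : sgraph) (P : pred {set G}) : {poly nat} :=
  (\sum_(A | independent A && P A) 'X^#|A|)%R.

Definition indep_all (G : sgraph) := indep_gen (xpredT : pred {set G}).
Definition indep_out (G : rgraph) := indep_gen (fun A : {set G} => root G \notin A).
Definition indep_in (G : rgraph) := indep_gen (fun A : {set G} => root G \in A).

Lemma indepP (G : sgraph) (A : {set G}) :
  reflect {in A &, forall x y, ~~ adj x y} (independent A).
Proof.
apply: (iffP forall_inP) => [h x y xA yA | h x xA].
  by have /forall_inP := h x xA; apply.
by apply/forall_inP => y yA; apply: h.
Qed.

Lemma indep_all_root (G : rgraph) : indep_all G = (indep_out G + indep_in G)%R.
Proof.
rewrite /indep_all /indep_gen (bigID (fun A : {set G} => root G \in A)) /= addrC.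
by congr (_ + _)%R; apply: eq_bigl => A; rewrite andbT.
Qed.

Lemma coef_indep_all (G : sgraph) (k : nat) : ((indep_all G)`_k)%R = num_indep G k.
Proof.
rewrite /indep_all /indep_gen coef_sum /num_indep -sum1_card.
under [LHS]eq_bigr do rewrite coefXn.
rewrite [RHS](eq_bigl (fun A : {set G} => independent A && (k == #|A|))); last first.
  by move=> A; rewrite inE eq_sym.
rewrite [RHS]big_mkcondr /=; apply: eq_big => [A|A _]; first by rewrite andbT.
by case: eqP.
Qed.

Lemma coef_indep_poly (G : sgraph) (k : nat) :
  ((indep_poly G)`_k = (num_indep G k)%:R)%R.
Proof.
rewrite /indep_poly coef_sum.
under eq_bigr do rewrite coefZ coefXn.
have [le_k|lt_k] := ltnP k #|G|.+1.
  rewrite (bigD1 (Ordinal le_k)) //= eqxx mulr1 big1 ?addr0 // => i ne_i.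
  by rewrite -val_eqE /= eq_sym in ne_i; rewrite (negPf ne_i) mulr0.
rewrite big1 => [|i _]; last by rewrite gtn_eqF ?mulr0 // (leq_trans (ltn_ord i)).
suff -> : num_indep G k = 0 by [].
apply/eqP; rewrite cards_eq0; apply/eqP/setP => A; rewrite !inE.
by apply/andP => -[_ /eqP Ak]; have := max_card (mem A); rewrite Ak leqNgt lt_k.
Qed.

Lemma breaks_indep_poly (G : sgraph) (k : nat) :
  ((indep_all G)`_k.+1)%R ^ 2 < ((indep_all G)`_k)%R * ((indep_all G)`_k.+2)%R ->
  breaks_log_concavity (fun i => (indep_poly G)`_i)%R k.+1.
Proof.
rewrite /breaks_log_concavity /= !coef_indep_poly -!coef_indep_all.
by rewrite -natrX -natrM ltr_nat.
Qed.

(** * Independence polynomials of attached trees *)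

Section AttachGen.
Variables (n : nat) (G : rgraph).

(** [glue] and [copies] match a vertex set of [attach n G] with a bit for the new root and one set
    per copy. *)
Let glue (b : bool) (f : {ffun 'I_n -> {set G}}) : {set attach n G} :=
  [set x | if x is Some (i, a) then a \in f i else b].

Let copies (A : {set attach n G}) : {ffun 'I_n -> {set G}} :=
  [ffun i => [set a | Some (i, a) \in A]].

Lemma card_glue b f : #|glue b f| = (b + \sum_i #|f i|)%N.
Proof.
rewrite -sum1_card big_mkcond /= (bigD1 None) //= inE.
congr (_ + _)%N.
rewrite (reindex_omap Some id); last by case.
under [RHS]eq_bigr do rewrite -sum1_card big_mkcond.
rewrite pair_big /=; apply: eq_big => [[i a]|[i a] _]; first by rewrite eqxx.
by rewrite inE.
Qed.

Lemma glueK b : cancel (glue b) copies.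
Proof. by move=> f; apply/ffunP => i; apply/setP => a; rewrite ffunE !inE. Qed.

Lemma copiesK (A : {set attach n G}) : glue (None \in A) (copies A) = A.
Proof. by apply/setP => -[[i a]|]; rewrite !inE ?ffunE ?inE. Qed.

Lemma independent_glue b f :
  independent (glue b f) =
  [forall i, independent (f i) && (b ==> (root G \notin f i))].
Proof.
apply/indepP/forallP => [h i | h].
  apply/andP; split.
    apply/indepP => x y xf yf.
    by have := h (Some (i, x)) (Some (i, y)); rewrite !inE /= eqxx; apply.
  apply/implyP => bT; apply/negP => rf.
  by have := h None (Some (i, root G)); rewrite !inE /= eqxx => /(_ bT rf).
move=> [[i x]|] [[j y]|]; rewrite !inE //= => xf yf.
- apply/nandP; case: eqP => [ij|]; last by left.
  right; subst j; have /andP[/indepP hi _] := h i; exact: hi.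
- by apply/eqP => xr; have /andP[_] := h i; rewrite yf -xr xf.
- by apply/eqP => yr; have /andP[_] := h j; rewrite xf -yr yf.
Qed.

(** Once the status of the new root is fixed, the copies are filled independently of each other, so
    the sum over families factors as an [n]-th power. *)
Lemma indep_gen_attach (b : bool) :
  indep_gen (fun A : {set attach n G} => (None \in A) == b) =
  ('X^b * indep_gen (fun B : {set G} => b ==> (root G \notin B)) ^+ n)%R.
Proof.
rewrite /indep_gen (reindex_onto (glue b) copies) => [|A /andP[_ /eqP <-]]; last first.
  exact: copiesK.
(* Written as a product over ['I_n], the power expands by distributivity into a sum over families of
   sets. *)
have -> (p : {poly nat}) : (p ^+ n = \prod_(i < n) p)%R.
  by rewrite prodr_const card_ord.
rewrite bigA_distr_big big_distrr /=.
apply: eq_big => [f|f _].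
  by rewrite glueK eqxx andbT inE eqxx andbT independent_glue.
by rewrite card_glue exprD -prodrXr.
Qed.

Lemma indep_out_attach : indep_out (attach n G) = (indep_all G ^+ n)%R.
Proof.
have := indep_gen_attach false; rewrite expr0 mul1r => <-.
by apply: eq_bigl => A; rewrite eqbF_neg.
Qed.

Lemma indep_in_attach : indep_in (attach n G) = ('X * indep_out G ^+ n)%R.
Proof.
have := indep_gen_attach true; rewrite expr1 => <-.
by apply: eq_bigl => A; rewrite eqb_id.
Qed.

End AttachGen.

Lemma indep_all_iso (G H : sgraph) (f : G -> H) :
  bijective f -> {mono f : x y / adj x y} -> indep_all G = indep_all H.
Proof.
move=> bij_f f_adj; have inj_f := bij_inj bij_f.
rewrite /indep_all /indep_gen [RHS](reindex (fun A : {set G} => f @: A)) /=.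
  apply: eq_big => [A|A _]; last by rewrite card_imset.
  rewrite !andbT; apply/indepP/indepP => hA.
    by move=> _ _ /imsetP[x xA ->] /imsetP[y yA ->]; rewrite f_adj hA.
  by move=> x y xA yA; rewrite -f_adj hA // imset_f.
have [g fK gK] := bij_f; apply: onW_bij.
by exists (fun A : {set H} => g @: A) => A; rewrite -imset_comp;
  [rewrite (eq_imset _ fK) | rewrite (eq_imset _ gK)]; rewrite imset_id.
Qed.

(** Seen from the pendant vertex, the graph is [attach 1 G], so the formulas for attached copies
    apply. *)
Lemma indep_all_pendant (G : rgraph) :
  indep_all (add_pendant G) = (indep_out G + indep_in G + 'X * indep_out G)%R.
Proof.
have -> : indep_all (add_pendant G) = indep_all (attach 1 G).
  pose f : add_pendant G -> attach 1 G := omap (pair ord0).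
  apply: (@indep_all_iso _ _ f).
    by exists (omap snd) => [[x|]|[[i x]|]] //; rewrite /f /= [i]ord1.
  by move=> [x|] [y|] //=; rewrite /adj /= eqxx.
by rewrite indep_all_root indep_out_attach indep_in_attach !expr1 indep_all_root.
Qed.

Lemma independent_subset1 (G : sgraph) (x : G) (A : {set G}) :
  A \subset [set x] -> independent A.
Proof.
move=> /subsetP sA; apply/indepP => y z /sA/set1P-> /sA/set1P->.
by rewrite adj_irr.
Qed.

Lemma indep_out_P2 : indep_out (rooted_path 1) = (1 + 'X)%R.
Proof.
rewrite /indep_out /indep_gen.
rewrite (eq_bigl (fun A => A \in [set set0; [set ord_max : pathG 2]])).
  rewrite big_setU1 ?inE /= ?big_set1 ?cards0 ?cards1 //.
  by apply/eqP => /setP/(_ ord_max); rewrite !inE.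
move=> A; rewrite !inE orbC -subset1; apply/andP/idP => [[_ r]|sA].
  apply/subsetP => -[[|[|k]] lt_k] //= xA; last by rewrite inE.
  by case/negP: r; rewrite (_ : Ordinal lt_k = ord0) in xA; last exact: val_inj.
split; first exact: independent_subset1 sA.
by apply/negP => /(subsetP sA); rewrite inE.
Qed.

Lemma indep_in_P2 : indep_in (rooted_path 1) = 'X%R.
Proof.
rewrite /indep_in /indep_gen (big_pred1 [set ord0 : pathG 2]) ?cards1 // => A.
apply/andP/eqP => [[/indepP iA rA]|->]; last first.
  by split; [exact: (@independent_subset1 (pathG 2) ord0) | rewrite inE].
apply/eqP; rewrite eqEsubset sub1set rA andbT; apply/subsetP => x xA.
have := iA _ _ rA xA; rewrite inE -val_eqE /adj /=.
by case: x xA => [[|[|k]] lt_k].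
Qed.

(** * Growth of the coefficients near the top degree *)

Lemma coefM_nat (p r : {poly nat}) (n : nat) :
  ((p * r)`_n)%R = \sum_(i < n.+1) (p`_i)%R * (r`_(n - i))%R.
Proof. exact: coefM. Qed.

Lemma coefM_ge (p r : {poly nat}) (a b : nat) :
  (p`_a)%R * (r`_b)%R <= ((p * r)`_(a + b))%R.
Proof.
have lt_a : a < (a + b).+1 by lia.
by rewrite coefM_nat (bigD1 (Ordinal lt_a)) //= addKn leq_addr.
Qed.

Lemma coefX_ge (p : {poly nat}) (a n : nat) : (p`_a)%R ^ n <= ((p ^+ n)`_(n * a))%R.
Proof.
elim: n => [|n IHn]; first by rewrite expr0 coef1.
rewrite exprS mulSn expnS; apply: leq_trans (coefM_ge _ _ _ _).
by rewrite leq_mul.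
Qed.

Lemma coefD_nat (p r : {poly nat}) (n : nat) : ((p + r)`_n)%R = (p`_n)%R + (r`_n)%R.
Proof. exact: coefD. Qed.

(* The exponent of 2^t in the coefficient j places below the top one: each loss
   of two degrees gains 3, a single remaining one gains 1. *)
Definition growth (j : nat) : nat := j + j./2.

(** Two odd arguments leave two single losses, which merge into one more pair. This superadditivity
    makes [top_bounded] stable under products. *)
Lemma growthD (i j : nat) : growth i + growth j <= growth (i + j).
Proof. rewrite /growth; lia. Qed.

Section TopBound.
Variables D q : nat.
Hypotheses (D_gt1 : 1 < D) (q_gt0 : 0 < q).

(* D absorbs every factor polynomial in t. *)
Definition top_bounded (d e E : nat) (p : {poly nat}) : Prop :=
  (forall k, d < k -> (p`_k)%R = 0) /\
  forall k j, k + j = d -> (p`_k)%R <= D ^ E * q ^ (e + growth j).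

Lemma top_bounded1 : top_bounded 0 0 0 1%R.
Proof.
split=> [k k_gt0|k j kj0]; first by rewrite coef1 gtn_eqF.
have [-> ->] : k = 0 /\ j = 0 by lia.
by rewrite coef1.
Qed.

(** The convolution has at most [d + d' + 1 <= D] terms, which costs one extra factor [D]. *)
Lemma top_boundedM d d' e e' E E' p r : d + d' < D ->
  top_bounded d e E p -> top_bounded d' e' E' r ->
  top_bounded (d + d') (e + e') (E + E').+1 (p * r)%R.
Proof.
move=> ltD [p0 pb] [r0 rb]; split=> [k lt_k|k j kj].
  rewrite coefM_nat big1 // => i _.
  have [/p0 -> //|le_i] := ltnP d i.
  by rewrite [X in _ * X]r0 ?muln0 //; lia.
rewrite coefM_nat.
apply: (@leq_trans (\sum_(i < k.+1) D ^ (E + E') * q ^ (e + e' + growth j))).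
  apply: leq_sum => i _; have := ltn_ord i.
  rewrite ltnS => le_ik.
  (* Terms beyond either degree vanish; for the others the two gaps below the top are true
     differences and add up to [j]. *)
  have [/p0 -> //|le_i] := ltnP d i.
  have [/r0 -> //|le_i'] := ltnP d' (k - i); first by rewrite muln0.
  apply: leq_trans (leq_mul (pb _ (d - i) _) (rb _ (d' - (k - i)) _)) _; try lia.
  rewrite mulnACA -!expnD leq_mul2l leq_pexp2l ?orbT //.
  have := growthD (d - i) (d' - (k - i)).
  have -> : d - i + (d' - (k - i)) = j by lia.
  lia.
rewrite sum_nat_const card_ord expnS mulnA leq_mul2r leq_mul2r.
by apply/orP; right; apply/orP; right; lia.
Qed.

Lemma top_boundedX d e E p n : n * d < D -> top_bounded d e E p ->
  top_bounded (n * d) (n * e) (n * E.+1) (p ^+ n)%R.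
Proof.
move=> ltD bp; elim: n ltD => [|n IHn] ltD; first exact: top_bounded1.
rewrite exprS !mulSn addSn; apply: top_boundedM bp (IHn _); lia.
Qed.

Lemma top_boundedD d e E E' p r :
  top_bounded d e E p -> top_bounded d e E' r ->
  top_bounded d e (E + E').+1 (p + r)%R.
Proof.
move=> [p0 pb] [r0 rb]; split=> [k lt_k|k j kj].
  by rewrite coefD_nat p0 ?r0.
rewrite coefD_nat; apply: leq_trans (leq_add (pb _ _ kj) (rb _ _ kj)) _.
rewrite -mulnDl leq_mul2r; apply/orP; right.
rewrite expnS expnD.
have : 0 < D ^ E /\ 0 < D ^ E' by rewrite !expn_gt0; lia.
move: (D ^ E) (D ^ E') => x y [x0 y0].
by apply: (@leq_trans (2 * (x * y))); [nia | rewrite leq_mul2r D_gt1 orbT].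
Qed.

(** Raising the reference degree by [c] increases every gap by [c], and the growth gained can pay
    for a smaller prefactor [e']. Summands of different degrees thus become comparable. *)
Lemma top_bounded_lift c d e e' E p :
  (forall j, e + growth j <= e' + growth (j + c)) ->
  top_bounded d e E p -> top_bounded (d + c) e' E p.
Proof.
move=> le_e [p0 pb]; split=> [k lt_k|k j kj]; first by apply: p0; lia.
have [/p0 -> //|le_kd] := ltnP d k.
apply: leq_trans (pb k (d - k) _) _; first lia.
rewrite leq_mul2l leq_pexp2l ?orbT //.
by have := le_e (d - k); have -> : d - k + c = j by lia.
Qed.

Lemma top_bounded_shift d e E p :
  top_bounded d e E p -> top_bounded d.+1 e E ('X * p)%R.
Proof.
move=> [p0 pb]; split=> [[|k] lt_k|[|k] j kj]; rewrite coefXM //=.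
  exact: p0.
by apply: pb; lia.
Qed.

End TopBound.

(** * Estimates for the powers of binomials, and exponential against polynomial growth *)

Lemma coef_binomial (t c k : nat) :
  (((1 + 'X *+ c) ^+ t : {poly nat})`_k)%R = c ^ k * 'C(t, k).
Proof.
rewrite exprDn coef_sum.
under eq_bigr do rewrite expr1n mul1r exprMn_n !coefMn coefXn.
have [le_k|lt_k] := leqP k t.
  rewrite (bigD1 (Ordinal (le_k : k < t.+1))) //= eqxx big1 ?addr0 => [|i ne_i].
    by rewrite -mulrnA natn.
  by rewrite -val_eqE eq_sym in ne_i; rewrite (negPf ne_i) !mul0rn.
rewrite bin_small // muln0 big1 // => i _.
by rewrite gtn_eqF ?mul0rn // (leq_trans (ltn_ord i)).
Qed.

Lemma bin_le_exp2 (t k : nat) : 'C(t, k) <= 2 ^ t.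
Proof.
have [lt_k|le_k] := ltnP t k; first by rewrite bin_small.
rewrite -[2]/(1 + 1) expnDn (bigD1 (Ordinal (le_k : k < t.+1))) //=.
by rewrite !exp1n !muln1 leq_addr.
Qed.

Lemma top_bounded_double (D t : nat) :
  top_bounded D (2 ^ t) t 1 0 ((1 + 'X *+ 2) ^+ t)%R.
Proof.
split=> [k lt_k|k j kj]; rewrite coef_binomial; first by rewrite bin_small ?muln0.
rewrite mul1n; case: j kj => [|j] kj.
  have -> : k = t by lia.
  by rewrite binn muln1 expn1.
(* Below the top, the crude bound [q ^ 2] suffices because [growth] is at least 1 there. *)
apply: (@leq_trans (2 ^ t * 2 ^ t)).
  by rewrite leq_mul ?bin_le_exp2 // leq_pexp2l //; lia.
by rewrite mulnn leq_pexp2l ?expn_gt0 // /growth; lia.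
Qed.

Lemma top_bounded_single (D t : nat) :
  top_bounded D (2 ^ t) t 0 0 ((1 + 'X) ^+ t)%R.
Proof.
rewrite -[('X)%R]mulr1n; split=> [k lt_k|k j kj]; rewrite coef_binomial.
  by rewrite bin_small ?muln0.
rewrite exp1n !mul1n; case: j kj => [|j] kj.
  have -> : k = t by lia.
  by rewrite binn.
apply: leq_trans (bin_le_exp2 _ _) _.
by rewrite -{1}[2 ^ t]expn1 leq_pexp2l ?expn_gt0 // /growth; lia.
Qed.

(** With [F = 2 * E + 1] and [u = t %/ F], the choice of [t0] forces [a * F < u]. Hence
    [a * t.+1 <= a * F * u.+1 <= 2 ^ (2 * u)], and [2 * u * E < F * u <= t]. *)
Lemma poly_lt_exp2 (a E : nat) :
  exists t0, forall t, t0 <= t -> (a * t.+1) ^ E < 2 ^ t.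
Proof.
exists ((a * (2 * E).+1).+1 * (2 * E).+1) => t.
set F := (2 * E).+1 => le_t.
pose u := t %/ F.
have le_u : a * F < u by rewrite /u leq_divRL.
have lt_t : t.+1 <= F * u.+1 by rewrite mulnC; exact: ltn_ceil.
have le_uF : F * u <= t by rewrite mulnC leq_divM.
have u_lt : u < 2 ^ u by exact: ltn_expl.
have le1 : a * t.+1 <= 2 ^ (2 * u).
  rewrite mul2n -addnn expnD.
  apply: leq_trans (leq_mul (leqnn a) lt_t) _.
  by rewrite mulnA; apply: leq_mul; lia.
apply: (@leq_ltn_trans ((2 ^ (2 * u)) ^ E)).
  by have [->|E_gt0] := posnP E; rewrite ?expn0 // leq_exp2r.
rewrite -expnM ltn_exp2l //; nia.
Qed.

(** * Two-sided coefficient estimates for the trees *)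

Section Trees.
Variable t : nat.
Let A : {poly nat} := ((1 + 'X *+ 2) ^+ t)%R.
Let B : {poly nat} := ((1 + 'X) ^+ t)%R.
Let S : {poly nat} := (A + 'X * B)%R.
Let T : {poly nat} := (S ^+ 3 + 'X * A ^+ 3)%R.

Lemma indep_out_S2 : indep_out (treeS2 t) = A.
Proof.
rewrite indep_out_attach indep_all_root indep_out_P2 indep_in_P2.
by rewrite -addrA -mulr2n.
Qed.

Lemma indep_all_S2 : indep_all (treeS2 t) = S.
Proof.
by rewrite indep_all_root indep_out_S2 indep_in_attach indep_out_P2.
Qed.

Lemma indep_all_T3 : indep_all (treeT 3 t) = T.
Proof.
rewrite indep_all_root indep_out_attach indep_in_attach.
by rewrite indep_all_S2 indep_out_S2.
Qed.

Lemma indep_all_TG m :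
  indep_all (treeTG m t) = (T ^+ m + 'X * (S ^+ 3) ^+ m + 'X * T ^+ m)%R.
Proof.
rewrite indep_all_pendant indep_out_attach indep_in_attach indep_all_T3.
by rewrite indep_out_attach indep_all_S2.
Qed.

(** In ['X * T ^+ m], take the term of degree [3 * t + 1] from [i] factors, each worth at least
    [q ^ 3] with [q = 2 ^ t], and the top term from the other [m - i]. *)
Lemma coef_TG_ge m i : i <= m ->
  (2 ^ t) ^ (3 * i) <=
  ((indep_all (treeTG m t))`_((m * (3 * t.+1)).+1 - 2 * i))%R.
Proof.
move=> le_im.
have A_t : (A`_t)%R = 2 ^ t by rewrite coef_binomial binn muln1.
have T_mid : (2 ^ t) ^ 3 <= (T`_(3 * t).+1)%R.
  rewrite coefD_nat coefXM /= -A_t.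
  by apply: leq_trans (leq_addl _ _); exact: coefX_ge.
have S_top : 0 < (S`_t.+1)%R.
  rewrite coefD_nat coefXM; apply: leq_trans (leq_addl _ _).
  by rewrite /= /B -[('X)%R]mulr1n coef_binomial exp1n binn.
have T_top : 0 < (T`_(3 * t.+1))%R.
  rewrite coefD_nat; apply: leq_trans (leq_addr _ _).
  by apply: leq_trans (coefX_ge _ _ _); rewrite expn_gt0 S_top.
rewrite indep_all_TG coefD_nat; apply: leq_trans (leq_addl _ _).
have -> : (m * (3 * t.+1)).+1 - 2 * i =
  (i * (3 * t).+1 + (m - i) * (3 * t.+1)).+1 by nia.
rewrite coefXM /= -{1}(subnKC le_im) exprD.
apply: leq_trans (coefM_ge _ _ _ _).
rewrite -[X in X <= _]muln1; apply: leq_mul.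
  apply: leq_trans (coefX_ge _ _ _); rewrite expnM.
  have [->|i_gt0] := posnP i; by rewrite ?expn0 // leq_exp2r.
by apply: leq_trans (coefX_ge _ _ _); rewrite expn_gt0 T_top.
Qed.

Lemma top_bounded_TG m D : (m * (3 * t.+1)).+1 < D -> (3 * t.+1).+1 < D ->
  top_bounded D (2 ^ t) (m * (3 * t.+1)).+1 0 (29 * m + 2)
    (indep_all (treeTG m t)).
Proof.
move=> ltmD lt3D; rewrite indep_all_TG.
have D_gt1 : 1 < D by lia.
have q_gt0 : 0 < 2 ^ t by rewrite expn_gt0.
have bA : top_bounded D (2 ^ t) t 1 0 A := top_bounded_double D t.
have bB : top_bounded D (2 ^ t) t 0 0 B := top_bounded_single D t.
have bS : top_bounded D (2 ^ t) t.+1 0 1 S.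
  apply: (top_boundedD D_gt1 q_gt0 (E := 0) (E' := 0)); last exact: top_bounded_shift.
  by rewrite -(addn1 t); apply: (top_bounded_lift D_gt1 q_gt0 _ bA) => j;
    rewrite /growth; lia.
have bS3 : top_bounded D (2 ^ t) (3 * t.+1) 0 6 (S ^+ 3)%R.
  by apply: (top_boundedX (e := 0) (E := 1) D_gt1 q_gt0) bS; lia.
(* The degree is two short of that of [S ^+ 3], and [growth (j + 2) = growth j + 3] absorbs exactly
   the leading factor [q ^ 3]. *)
have bA3 : top_bounded D (2 ^ t) (3 * t.+1) 0 3 ('X * A ^+ 3)%R.
  have -> : 3 * t.+1 = (3 * t + 2).+1 by lia.
  apply: (top_bounded_shift D_gt1 q_gt0).
  apply: (top_bounded_lift D_gt1 q_gt0 (e := 3 * 1)) => [j|].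
    by rewrite /growth; lia.
  by apply: (top_boundedX (e := 1) (E := 0) D_gt1 q_gt0) bA; lia.
have bT : top_bounded D (2 ^ t) (3 * t.+1) 0 10 T.
  exact: (top_boundedD D_gt1 q_gt0 bS3 bA3).
have bTm : top_bounded D (2 ^ t) (m * (3 * t.+1)) 0 (m * 11) (T ^+ m)%R.
  by rewrite -[X in top_bounded _ _ _ X _ _](muln0 m); apply: top_boundedX (bT); lia.
have bSm : top_bounded D (2 ^ t) (m * (3 * t.+1)) 0 (m * 7) ((S ^+ 3) ^+ m)%R.
  by rewrite -[X in top_bounded _ _ _ X _ _](muln0 m); apply: top_boundedX bS3; lia.
(* The powers of [T] and [S ^+ 3] cost 10 + 1 and 6 + 1 per factor; each of the two additions costs
   one more. *)
have -> : 29 * m + 2 = ((m * 11 + m * 7).+1 + m * 11).+1 by lia.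
apply: top_boundedD => //; last exact: top_bounded_shift.
apply: top_boundedD => //; last exact: top_bounded_shift.
by rewrite -(addn1 (m * _)); apply: (top_bounded_lift D_gt1 q_gt0 _ bTm) => j;
  rewrite /growth; lia.
Qed.

End Trees.

Theorem theorem2p9 (m : nat) (hm : (0 < m)%N) :
  exists t0 : nat, forall t : nat, (t0 <= t)%N ->
    exists K : seq nat,
      [/\ uniq K, size K = m &
          forall k : nat, k \in K ->
            breaks_log_concavity (fun i : nat => (indep_poly (treeTG m t))`_i)%R k].
Proof.
(* The factor [3 * m + 5] puts [D] above both degree bounds required by [top_bounded_TG]; the
   exponent is doubled because the upper bound gets squared. *)
have [t0 ht0] := poly_lt_exp2 (3 * m + 5) (2 * (29 * m + 2)).
exists t0 => t /ht0; set D := (3 * m + 5) * t.+1 => lt_D.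
set N := (m * (3 * t.+1)).+1.
exists [seq N - (2 * i).+1 | i <- iota 0 m]; split.
- rewrite map_inj_in_uniq ?iota_uniq // => i j.
  rewrite !mem_iota /N; nia.
- by rewrite size_map size_iota.
move=> k /mapP[i]; rewrite mem_iota => /andP[_ lt_im] ->.
(* This keeps the truncated subtractions from [N] exact. *)
have lt_iN : 2 * i.+1 < N by rewrite /N; nia.
have -> : N - (2 * i).+1 = (N - 2 * i.+1).+1 by lia.
apply: breaks_indep_poly.
have [_ bTG] : top_bounded D (2 ^ t) N 0 (29 * m + 2) (indep_all (treeTG m t)).
  by apply: top_bounded_TG; rewrite /D; nia.
have up := bTG (N - 2 * i.+1).+1 (2 * i).+1 ltac:(lia).
have lo1 := coef_TG_ge t (ltnW lt_im : i <= m).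
have lo2 := coef_TG_ge t (lt_im : i.+1 <= m).
have e2 : (N - 2 * i.+1).+2 = N - 2 * i by lia.
rewrite e2; apply: leq_trans (leq_mul lo2 lo1).
have g : growth (2 * i).+1 = 3 * i + 1 by rewrite /growth; lia.
rewrite g add0n in up.
apply: (@leq_ltn_trans ((D ^ (29 * m + 2) * (2 ^ t) ^ (3 * i + 1)) ^ 2)).
  by rewrite leq_sqr.
(* One factor [2 ^ t] is left over to beat the squared power of [D]. *)
have -> : (2 ^ t) ^ (3 * i.+1) * (2 ^ t) ^ (3 * i) =
  2 ^ t * ((2 ^ t) ^ (3 * i + 1)) ^ 2.
  by move: (2 ^ t) => q; rewrite -expnM -expnD -expnS; congr (_ ^ _); lia.
by rewrite expnMn ltn_pmul2r ?expn_gt0 // -expnM mulnC.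
Qed.
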